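(* For any classical-quantum channel $W:\mathcal{X}\to\mathcal{S}(\mathcal{H})$ with $\mathcal{X}$ finite and $\mathcal{H}$ finite-dimensional, $R(W)\le C(W)$, where $C(W):=\sup_{p\in\mathcal{P}(\mathcal{X})}I(X;B)_{W\times p}$.
   Context: $\mathcal{S}(\mathcal{H})$ is the set of density matrices on $\mathcal{H}$, $\mathcal{P}(\mathcal{X})$ the set of probability distributions on $\mathcal{X}$. For $p\in\mathcal{P}(\mathcal{X})$, $W(p)=\sum_xp(x)W_x$ and $I(X;B)_{W\times p}=\sum_xp(x)D(W_x\|W(p))$ with $D(\rho\|\sigma)=\mathrm{Tr}\,\rho(\log\rho-\log\sigma)$, logarithms base 2. For $x^n\in\mathcal{X}^n$, $W^{\otimes n}_{x^n}=W_{x_1}\otimes\cdots\otimes W_{x_n}$ and for a distribution $p^n$ on $\mathcal{X}^n$, $W^{\otimes n}(p^n)=\sum_{x^n}p^n(x^n)W^{\otimes n}_{x^n}$. $\mathcal{P}_M(\mathcal{X}^n)$ is the set of distributions $q$ on $\mathcal{X}^n$ with $Mq(x^n)\in\mathbb{Z}$ for all $x^n$. $\varepsilon(W^{\otimes n},M):=\sup_{p^n\in\mathcal{P}(\mathcal{X}^n)}\inf_{q^n\in\mathcal{P}_M(\mathcal{X}^n)}\frac12\|W^{\otimes n}(p^n)-W^{\otimes n}(q^n)\|_1$, and $R(W):=\inf\{R>0:\ \forall\gamma>0,\ \liminf_{n\to\infty}\varepsilon(W^{\otimes n},\lfloor2^{n(R+\gamma)}\rfloor)=0\}$. *)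

(* Defs.v *)
From HB Require Import structures.
From mathcomp Require Import all_boot all_order all_algebra.
From mathcomp Require Import sesquilinear spectral.
From mathcomp Require Import complex.
From mathcomp Require Import all_classical all_reals all_analysis.

Set Implicit Arguments.
Unset Strict Implicit.
Unset Printing Implicit Defensive.

Import Order.TTheory GRing.Theory Num.Theory.
Local Open Scope ring_scope.
Local Open Scope classical_set_scope.

Section QuantumDefs.
Variable R : realType.
Local Notation C := (R[i]).

Definition density (d : nat) (rho : 'M[C]_d) : Prop :=
  rho \is hermsymmx /\
  (forall v : 'rV[C]_d, 0 <= (v *m rho *m (map_mx Num.conj (v^T))) 0 0) /\
  \tr rho = 1.

(* Functional calculus f(A) for a Hermitian (more generally normal) matrix,
   via the spectral decomposition A = P^-1 diag(lambda) P of mathcomp's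
   spectral.v; f is applied to the (real) eigenvalues. *)
Definition mxfun (d : nat) (f : R -> R) (A : 'M[C]_d) : 'M[C]_d :=
  invmx (spectralmx A) *m
  diag_mx (map_mx (fun z : C => ((f (complex.Re z))%:C)%C) (spectral_diag A))
  *m spectralmx A.

(* base-2 logarithm, with the support convention log 0 := 0 on eigenvalues
   (i.e. the logarithm is taken on the support). *)
Definition log2 (x : R) : R := if 0 < x then ln x / ln 2 else 0.

Definition relent (d : nat) (rho sigma : 'M[C]_d) : R :=
  complex.Re (\tr (rho *m (mxfun log2 rho - mxfun log2 sigma))).

Definition trnorm (d : nat) (A : 'M[C]_d) : R :=
  complex.Re (\tr (mxfun Num.sqrt (map_mx Num.conj (A^T) *m A))).

Definition is_distr (T : finType) (p : {ffun T -> R}) : Prop :=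
  (forall x, 0 <= p x) /\ \sum_(x : T) p x = 1.

Variables (X : finType) (d : nat) (W : X -> 'M[C]_d).

Definition avg (p : {ffun X -> R}) : 'M[C]_d :=
  \sum_(x : X) ((p x)%:C)%C *: W x.

Definition mutinf (p : {ffun X -> R}) : R :=
  \sum_(x : X) p x * relent (W x) (avg p).

Definition capacity : \bar R :=
  ereal_sup [set (mutinf p)%:E | p in [set p | is_distr p]].

(* H^{(x)n} is C^(d^n), with orthonormal basis indexed by words in 'I_d^n;
   we index its matrices by 'I_#|{ffun 'I_n -> 'I_d}| through enum_val. *)
Definition word_ty (n : nat) := {ffun 'I_n -> 'I_d}.

(* W^{(x)n}_{x^n} = W_{x_1} (x) ... (x) W_{x_n} (Kronecker product). *)
Definition tensW (n : nat) (xn : {ffun 'I_n -> X}) :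
  'M[C]_#|word_ty n| :=
  \matrix_(a, b) \prod_(k < n)
     W (xn k) (@enum_val (word_ty n) predT a k) (@enum_val (word_ty n) predT b k).

Definition avgn (n : nat) (pn : {ffun {ffun 'I_n -> X} -> R}) :
  'M[C]_#|word_ty n| :=
  \sum_(xn : {ffun 'I_n -> X}) ((pn xn)%:C)%C *: tensW xn.

Definition is_typeM (n : nat) (M : int) (q : {ffun {ffun 'I_n -> X} -> R}) :
  Prop := forall xn, exists z : int, M%:~R * q xn = z%:~R.

Definition eps (n : nat) (M : int) : \bar R :=
  ereal_sup [set
    ereal_inf [set ((2^-1) * trnorm (avgn p - avgn q))%:E
               | q in [set q : {ffun {ffun 'I_n -> X} -> R} | is_distr q /\ is_typeM M q]]
  | p in [set p : {ffun {ffun 'I_n -> X} -> R} | is_distr p]].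

Definition rateW : \bar R :=
  ereal_inf [set r%:E | r in
    [set r : R | 0 < r /\
       forall g : R, 0 < g ->
         limn_einf (fun n : nat =>
            eps n (Num.floor (2 `^ (n%:R * (r + g))))) = 0%E]].

End QuantumDefs.

(* Main.v *)
Require Import Defs.
From HB Require Import structures.
From mathcomp Require Import all_boot all_order all_algebra.
From mathcomp Require Import sesquilinear spectral complex.
From mathcomp Require Import all_classical all_reals all_analysis.
From mathcomp Require Import ring lra.

(** Random coding within type classes.  Fix a word [y] of type [P] and put
    [rho = W(P)].  Two Chebyshev bounds for product distributions show that, up
    to a trace-norm error which is [O(n^(-1/2))] uniformly in [y], the state
    [W_y] may be replaced by [Pi B_y]: here [B_y] keeps the eigenvalues of
    [W_y] below [2^(-n (sum_x P(x) S(W_x) - dl))], and [Pi] projects on the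
    eigenvectors of [rho^(tensor n)] with eigenvalue at least
    [2^(-n (S(rho) + dl))].  The variance bounds are uniform in [P] because
    [P] averages the laws of [W_x] in the eigenbasis of [rho] to the spectrum
    of [rho], and [s (log s)^2] is bounded.  Now draw [M] words independently
    from [p^n].  The Hilbert-Schmidt variance of the truncated empirical state
    is at most [2^(-n (sum_x P(x) S(W_x) - dl)) / M], and
    [|A|_1^2 <= (rank A) |A|_2^2] costs a factor [2^(n (S(rho) + dl))], hence
    the squared error on one type class is at most
    [2^(n (I(P) + 2 dl)) / M <= 2^(n (C(W) + 2 dl)) / M].  There are only
    polynomially many type classes. *)

Set Implicit Arguments.
Unset Strict Implicit.
Unset Printing Implicit Defensive.

Import Order.TTheory GRing.Theory Num.Theory numFieldNormedType.Exports.
Local Open Scope ring_scope.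

(** * Product distributions *)

Section ProductWeights.
Variables (R : realFieldType) (I J : finType) (mu : I -> J -> R).
Hypothesis mu_sum1 : forall i, \sum_j mu i j = 1.

Lemma sum_prod_weight1 : \sum_(k : {ffun I -> J}) \prod_i mu i (k i) = 1.
Proof. by rewrite -(bigA_distr_bigA mu) big1. Qed.

Lemma sum_prod_weight_marginal (i : I) (h : J -> R) :
  \sum_(k : {ffun I -> J}) (\prod_l mu l (k l)) * h (k i)
    = \sum_j mu i j * h j.
Proof.
(* [h] is absorbed into the weight of coordinate [i], so that the sum over words factors into a
   product of one-letter sums. *)
pose phi l j := mu l j * (if l == i then h j else 1).
transitivity (\sum_(k : {ffun I -> J}) \prod_l phi l (k l)).
  apply: eq_bigr => k _; rewrite big_split /=; congr (_ * _).
  by rewrite -big_mkcond big_pred1_eq.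
rewrite -(bigA_distr_bigA phi) (bigD1 i) //= [X in _ * X]big1 ?mulr1.
  by apply: eq_bigr => j _; rewrite /phi eqxx.
by move=> l /negPf li; under eq_bigr do rewrite /phi li mulr1.
Qed.

Lemma sum_prod_weight_cross (i l : I) (g h : J -> R) : l != i ->
  \sum_j mu l j * h j = 0 ->
  \sum_(k : {ffun I -> J}) (\prod_m mu m (k m)) * (g (k i) * h (k l)) = 0.
Proof.
move=> li h0.
pose phi m j := mu m j * ((if m == i then g j else 1) *
                          (if m == l then h j else 1)).
transitivity (\sum_(k : {ffun I -> J}) \prod_m phi m (k m)).
  apply: eq_bigr => k _; rewrite big_split /= big_split /=; congr (_ * (_ * _)).
    by rewrite -big_mkcond big_pred1_eq.
  by rewrite -big_mkcond big_pred1_eq.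
rewrite -(bigA_distr_bigA phi) (bigD1 l) //=.
under eq_bigr do rewrite /phi (negPf li) eqxx mul1r.
by rewrite h0 mul0r.
Qed.

(** Variances of independent centered variables add: after expanding the square, the off-diagonal
    terms vanish by independence. *)
Lemma sum_prod_weight_sqr (h : I -> J -> R) :
  (forall i, \sum_j mu i j * h i j = 0) ->
  \sum_(k : {ffun I -> J}) (\prod_i mu i (k i)) * (\sum_i h i (k i)) ^+ 2
    = \sum_i \sum_j mu i j * h i j ^+ 2.
Proof.
move=> h0.
transitivity (\sum_(k : {ffun I -> J}) \sum_i \sum_l
    (\prod_m mu m (k m)) * (h i (k i) * h l (k l))).
  apply: eq_bigr => k _; rewrite expr2 big_distrlr /= big_distrr /=.
  by apply: eq_bigr => i _; rewrite big_distrr.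
rewrite exchange_big /=; apply: eq_bigr => i _.
rewrite exchange_big /= (bigD1 i) //= [X in _ + X]big1 ?addr0.
  rewrite -(sum_prod_weight_marginal i (fun j => h i j ^+ 2)).
  by apply: eq_bigr => k _; rewrite expr2.
by move=> l li; apply: sum_prod_weight_cross.
Qed.

Hypothesis mu_ge0 : forall i j, 0 <= mu i j.

Lemma sum_centered_sqr_le (i : I) (g : J -> R) :
  \sum_j mu i j * (g j - \sum_l mu i l * g l) ^+ 2 <= \sum_j mu i j * g j ^+ 2.
Proof.
set m := \sum_l mu i l * g l.
have -> : \sum_j mu i j * (g j - m) ^+ 2 = \sum_j mu i j * g j ^+ 2 - m ^+ 2.
  transitivity (\sum_j mu i j * g j ^+ 2 - \sum_j mu i j * g j * (2 * m)
                + \sum_j mu i j * m ^+ 2).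
    rewrite -sumrB -big_split /=; apply: eq_bigr => j _; ring.
  rewrite -!mulr_suml mu_sum1 -/m; ring.
by rewrite gerBl sqr_ge0.
Qed.

Lemma sum_centered_eq0 (i : I) (g : J -> R) :
  \sum_j mu i j * (g j - \sum_l mu i l * g l) = 0.
Proof.
under eq_bigr do rewrite mulrBr.
by rewrite sumrB -mulr_suml mu_sum1 mul1r subrr.
Qed.

(** The deviation is assumed only on words of nonzero weight, because logarithms of probabilities
    will be controlled only there. Variances are relaxed to second moments, which is what
    [log2_sqr_le] bounds. *)
Lemma chebyshev_prod_weight (g : I -> J -> R) (c : R)
    (P : pred {ffun I -> J}) :
  0 < c ->
  (forall k, P k -> \prod_i mu i (k i) != 0 ->
     c <= `|\sum_i g i (k i) - \sum_i \sum_j mu i j * g i j|) ->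
  \sum_(k | P k) \prod_i mu i (k i)
    <= (\sum_i \sum_j mu i j * g i j ^+ 2) / c ^+ 2.
Proof.
move=> c0 Pc; rewrite ler_pdivlMr ?exprn_gt0 //.
pose h i j := g i j - \sum_l mu i l * g i l.
apply: (@le_trans _ _
  (\sum_(k : {ffun I -> J}) (\prod_i mu i (k i)) * (\sum_i h i (k i)) ^+ 2)).
  rewrite mulr_suml big_mkcond /=; apply: ler_sum => k _.
  have w0 : 0 <= \prod_i mu i (k i) by apply: prodr_ge0.
  case: ifPn => [Pk|_]; last by rewrite mulr_ge0 ?sqr_ge0.
  have [->|wn0] := eqVneq (\prod_i mu i (k i)) 0; first by rewrite !mul0r.
  apply: ler_wpM2l => //.
  rewrite -[leRHS]real_normK ?num_real // ler_pXn2r ?nnegrE ?(ltW c0) //.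
  by rewrite /h sumrB Pc.
rewrite sum_prod_weight_sqr => [|i]; last exact: sum_centered_eq0.
by apply: ler_sum => i _; apply: sum_centered_sqr_le.
Qed.

End ProductWeights.

(** * Random codebooks *)

Section Sampling.
Variables (R : realFieldType) (Y : finType) (p : Y -> R).
Hypothesis p_ge0 : forall y, 0 <= p y.
Hypothesis p_sum1 : \sum_y p y = 1.

Lemma sample_mean_variance (M : nat) (b : Y -> R) : (0 < M)%N ->
  \sum_(f : {ffun 'I_M -> Y}) (\prod_i p (f i)) *
     (\sum_y p y * b y - M%:R^-1 * \sum_i b (f i)) ^+ 2
  <= M%:R^-1 * \sum_y p y * b y ^+ 2.
Proof.
move=> M0; have Mn0 : M%:R != 0 :> R by rewrite pnatr_eq0 -lt0n.
set m := \sum_y p y * b y.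
have s1 : forall i : 'I_M, \sum_y p y = 1 by [].
pose h (i : 'I_M) y := b y - m.
have -> : \sum_(f : {ffun 'I_M -> Y}) (\prod_i p (f i)) *
     (m - M%:R^-1 * \sum_i b (f i)) ^+ 2 =
   M%:R ^- 2 * \sum_(f : {ffun 'I_M -> Y}) (\prod_i p (f i)) *
     (\sum_i h i (f i)) ^+ 2.
  rewrite big_distrr /=; apply: eq_bigr => f _.
  rewrite /h sumrB sumr_const card_ord -[m *+ M]mulr_natl.
  by field.
rewrite (sum_prod_weight_sqr (mu := fun _ => p) s1); last first.
  by move=> i; apply: (sum_centered_eq0 (mu := fun _ => p) s1 i b).
rewrite (eq_bigr (fun=> \sum_y p y * (b y - m) ^+ 2)) // sumr_const card_ord
  -[X in _ * X <= _]mulr_natl.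
have cancelM (z : R) : M%:R ^- 2 * (M%:R * z) = M%:R^-1 * z by field.
rewrite cancelM.
rewrite ler_wpM2l ?invr_ge0 //.
(* A family indexed by the one-point type ['I_1] stands for the single law [p]. *)
exact: (@sum_centered_sqr_le _ 'I_1 _ (fun _ => p) (fun _ => p_sum1) ord0).
Qed.

(** If [w] exceeded [K] everywhere, the nonnegative terms [p y * (w y - K)] would have a sum at most
    0, forcing [p] to vanish. *)
Lemma exists_le_average (w : Y -> R) (K : R) :
  \sum_y p y * w y <= K -> exists y, w y <= K.
Proof.
move=> wK; apply: contrapT => nw.
have Kw y : K < w y by rewrite ltNge; apply/negP => wy; apply: nw; exists y.
have : \sum_y p y * (w y - K) <= 0.
  under eq_bigr do rewrite mulrBr.
  by rewrite sumrB -mulr_suml p_sum1 mul1r subr_le0.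
move=> s0; have s0' : \sum_y p y * (w y - K) = 0.
  apply/eqP; rewrite eq_le s0 /=; apply: sumr_ge0 => y _.
  by rewrite mulr_ge0 // subr_ge0 ltW.
have pz y : p y = 0.
  have /eqP := s0'; rewrite psumr_eq0; last first.
    by move=> z _; rewrite mulr_ge0 // subr_ge0 ltW.
  move/allP/(_ y); rewrite mem_index_enum => /(_ isT) /=.
  by rewrite mulf_eq0 subr_eq0 (gt_eqF (Kw y)) orbF => /eqP.
by have := p_sum1; rewrite big1 // => /eqP; rewrite eq_sym oner_eq0.
Qed.

End Sampling.

(** The variance bound is averaged over i.i.d. codebooks one coordinate [e] at a time; some codebook
    then does no worse than the average of the weighted total. *)
Lemma exists_codebook (R : realFieldType) (Y E : finType) (p : Y -> R)
    (w : E -> R) (b : E -> Y -> R) (M : nat) :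
  (forall y, 0 <= p y) -> \sum_y p y = 1 -> (forall e, 0 <= w e) -> (0 < M)%N ->
  exists f : {ffun 'I_M -> Y},
    \sum_e w e * (\sum_y p y * b e y - M%:R^-1 * \sum_i b e (f i)) ^+ 2
    <= M%:R^-1 * \sum_e w e * \sum_y p y * b e y ^+ 2.
Proof.
move=> p0 p1 w0 M0.
apply: (@exists_le_average _ _ (fun f : {ffun 'I_M -> Y} => \prod_i p (f i))).
- by move=> f; apply: prodr_ge0.
- exact: (sum_prod_weight1 (mu := fun _ => p)).
under eq_bigr do rewrite big_distrr /=.
rewrite exchange_big /= big_distrr /=; apply: ler_sum => e _.
under eq_bigr do rewrite mulrCA.
rewrite -big_distrr /= mulrCA; apply: ler_wpM2l => //.
exact: sample_mean_variance.
Qed.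

(** * Hilbert-Schmidt norm and trace norm *)

Lemma sum_mul_le_sqrt (R : rcfType) (E : finType) (a b : E -> R) :
  \sum_e a e * b e
    <= Num.sqrt (\sum_e a e ^+ 2) * Num.sqrt (\sum_e b e ^+ 2).
Proof.
rewrite -sqrtrM ?sumr_ge0 // => [|e _]; last exact: sqr_ge0.
apply: le_trans (ler_norm _) _; rewrite -sqrtr_sqr ler_wsqrtr //.
(* Lagrange's identity: this double sum is twice the defect in the Cauchy-Schwarz inequality. *)
suff : 0 <= \sum_e \sum_l (a e * b l - a l * b e) ^+ 2.
  have -> : \sum_e \sum_l (a e * b l - a l * b e) ^+ 2 =
      2 * ((\sum_e a e ^+ 2) * (\sum_e b e ^+ 2) - (\sum_e a e * b e) ^+ 2).
    transitivity (\sum_e \sum_l (a e ^+ 2 * b l ^+ 2 +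
        b e ^+ 2 * a l ^+ 2 - 2 * ((a e * b e) * (a l * b l)))).
      by apply: eq_bigr => e _; apply: eq_bigr => l _; ring.
    rewrite expr2 (mulrC (\sum_e a e ^+ 2)) {1}mulrC.
    under eq_bigr do rewrite sumrB big_split /= -!mulr_sumr.
    rewrite sumrB big_split /= -!mulr_sumr -!mulr_suml; ring.
  by rewrite pmulr_rge0 // subr_ge0.
by apply: sumr_ge0 => e _; apply: sumr_ge0 => l _; apply: sqr_ge0.
Qed.

(* Sealing the operations below keeps unification from unfolding matrices over
   R[i] down to the real coordinates of their entries. *)
Fact hs_key : unit. Proof. exact: tt. Qed.

Section HilbertSchmidt.
Variable R : realType.
Local Notation C := (R[i]).
Local Open Scope sesquilinear_scope.

Definition cpart (e : bool) (z : C) : R := if e then complex.Re z else complex.Im z.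

(** The squared Hilbert-Schmidt norm as one sum over real coordinates, the form in which
    [exists_codebook] and the real Cauchy-Schwarz inequality apply. *)
Definition hs2 m n (A : 'M[C]_(m, n)) : R :=
  \sum_(e : 'I_m * 'I_n * bool) cpart e.2 (A e.1.1 e.1.2) ^+ 2.

Lemma ReD (x y : C) : complex.Re (x + y) = complex.Re x + complex.Re y.
Proof. by case: x; case: y. Qed.

Lemma ReN (x : C) : complex.Re (- x) = - complex.Re x.
Proof. by case: x. Qed.

Lemma Re_sum (I : Type) (r : seq I) (P : pred I) (F : I -> C) :
  complex.Re (\sum_(i <- r | P i) F i) = \sum_(i <- r | P i) complex.Re (F i).
Proof. exact: (big_morph _ ReD). Qed.

Lemma Re_mulr_real (c : R) (z : C) :
  complex.Re ((c%:C)%C * z) = c * complex.Re z.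
Proof. by case: z => a b /=; rewrite mul0r subr0. Qed.

Lemma Im_mulr_real (c : R) (z : C) :
  complex.Im ((c%:C)%C * z) = c * complex.Im z.
Proof. by case: z => a b /=; rewrite mul0r addr0. Qed.

Lemma ImD (x y : C) : complex.Im (x + y) = complex.Im x + complex.Im y.
Proof. by case: x; case: y. Qed.

Lemma cpartD e (x y : C) : cpart e (x + y) = cpart e x + cpart e y.
Proof. by case: e; rewrite /= ?ReD ?ImD. Qed.

Lemma cpart_sum e (I : Type) (r : seq I) (P : pred I) (F : I -> C) :
  cpart e (\sum_(i <- r | P i) F i) = \sum_(i <- r | P i) cpart e (F i).
Proof. by apply: (big_morph _ (cpartD e)); case: e. Qed.

Lemma cpart_mulr_real e (c : R) (z : C) :
  cpart e ((c%:C)%C * z) = c * cpart e z.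
Proof. by case: e; rewrite /= ?Re_mulr_real ?Im_mulr_real. Qed.

Lemma ge0_complexE (z : C) : 0 <= z -> z = ((complex.Re z)%:C)%C.
Proof. by move=> z0; rewrite RRe_real // ger0_real. Qed.

Lemma ge0_Re (z : C) : 0 <= z -> 0 <= complex.Re z.
Proof. by move=> z0; rewrite -ler0c -ge0_complexE. Qed.

Lemma hs2_ge0 m n (A : 'M[C]_(m, n)) : 0 <= hs2 A.
Proof. by apply: sumr_ge0 => e _; apply: sqr_ge0. Qed.

Lemma hs2_sum m n (A : 'M[C]_(m, n)) :
  hs2 A = \sum_i \sum_j complex.Re (A i j * (A i j)^*).
Proof.
rewrite /hs2 pair_big /= -(pair_big predT predT
  (fun ij e => cpart e (A ij.1 ij.2) ^+ 2)) /=.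
apply: eq_bigr => -[i j] _ /=; rewrite big_bool /=.
by case: (A i j) => a b /=; rewrite mulrN opprK !expr2.
Qed.

Definition adj m n (A : 'M[C]_(m, n)) : 'M[C]_(n, m) :=
  locked_with hs_key (map_mx Num.conj (A^T)).

Lemma adj_def m n (A : 'M[C]_(m, n)) : adj A = map_mx Num.conj (A^T).
Proof. exact: locked_withE. Qed.

Lemma adjE m n (A : 'M[C]_(m, n)) i j : adj A i j = (A j i)^*.
Proof. by rewrite adj_def !mxE. Qed.

Lemma adjK m n (A : 'M[C]_(m, n)) : adj (adj A) = A.
Proof. by apply/matrixP => i j; rewrite !adjE conjCK. Qed.

Lemma hs2_trace m n (A : 'M[C]_(m, n)) : hs2 A = complex.Re (\tr (A *m adj A)).
Proof.
rewrite hs2_sum /mxtrace Re_sum; apply: eq_bigr => i _.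
by rewrite mxE Re_sum; apply: eq_bigr => j _; rewrite adjE.
Qed.

Lemma hs2_diag m n (A : 'M[C]_(m, n)) :
  hs2 A = \sum_i complex.Re ((A *m adj A) i i).
Proof. by rewrite hs2_trace /mxtrace Re_sum. Qed.

Lemma adjM m n p (A : 'M[C]_(m, n)) (B : 'M[C]_(n, p)) :
  adj (A *m B) = adj B *m adj A.
Proof.
apply/matrixP => i j; rewrite adjE !mxE rmorph_sum; apply: eq_bigr => k _.
by rewrite !adjE rmorphM mulrC.
Qed.

Lemma hs2_adj m n (A : 'M[C]_(m, n)) : hs2 (adj A) = hs2 A.
Proof.
rewrite !hs2_sum exchange_big /=; apply: eq_bigr => i _; apply: eq_bigr => j _.
by rewrite !adjE conjCK mulrC.
Qed.

Definition unitary n (V : 'M[C]_n) : Prop := V *m adj V = 1%:M.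

Lemma unitary_adj_mul n (V : 'M[C]_n) : unitary V -> adj V *m V = 1%:M.
Proof. exact: mulmx1C. Qed.

Lemma adj_unitary n (V : 'M[C]_n) : unitary V -> unitary (adj V).
Proof. by move=> uV; rewrite /unitary adjK; apply: unitary_adj_mul. Qed.

Lemma spectral_unitary n (A : 'M[C]_n) : unitary (spectralmx A).
Proof. by rewrite /unitary adj_def; apply/unitarymxP/spectral_unitarymx. Qed.

Lemma invmx_spectral n (A : 'M[C]_n) : invmx (spectralmx A) = adj (spectralmx A).
Proof. by rewrite adj_def; apply/invmx_unitary/spectral_unitarymx. Qed.

Lemma hs2_mul_unitary m n (A : 'M[C]_(m, n)) (V : 'M[C]_n) :
  unitary V -> hs2 (A *m V) = hs2 A.
Proof.
move=> uV; rewrite !hs2_trace adjM mulmxA -(mulmxA A) uV.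
by rewrite mulmx1.
Qed.

Lemma hs2_unitary_mul m n (A : 'M[C]_(m, n)) (V : 'M[C]_m) :
  unitary V -> hs2 (V *m A) = hs2 A.
Proof.
move=> uV; rewrite -hs2_adj adjM hs2_mul_unitary ?hs2_adj //.
exact: adj_unitary.
Qed.

Lemma Re_trace_mul_le m n (A : 'M[C]_(m, n)) (B : 'M[C]_(n, m)) :
  complex.Re (\tr (A *m B)) <= Num.sqrt (hs2 A) * Num.sqrt (hs2 B).
Proof.
(* The sign comes from [Re (z w) = Re z Re w - Im z Im w]; it does not affect squares. *)
pose b (e : 'I_m * 'I_n * bool) : R :=
  (if e.2 then 1 else -1) * cpart e.2 (B e.1.2 e.1.1).
have -> : hs2 B = \sum_e b e ^+ 2.
  rewrite /hs2 (reindex (fun e : 'I_m * 'I_n * bool => (e.1.2, e.1.1, e.2))) /=.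
    by apply: eq_bigr => -[[i j] []] _; rewrite /b /= ?mul1r ?mulN1r ?sqrrN.
  by exists (fun e => (e.1.2, e.1.1, e.2)) => -[[? ?] ?].
have -> : complex.Re (\tr (A *m B)) = \sum_e cpart e.2 (A e.1.1 e.1.2) * b e.
  rewrite -(pair_big predT predT (fun ij e => cpart e (A ij.1 ij.2) * b (ij, e))) /=.
  rewrite -(pair_big predT predT
    (fun i j => \sum_e cpart e (A i j) * b ((i, j), e))) /=.
  rewrite Re_sum; apply: eq_bigr => i _.
  rewrite !mxE Re_sum; apply: eq_bigr => j _; rewrite big_bool /b /=.
  by case: (A i j) (B j i) => a1 a2 [b1 b2] /=; ring.
exact: sum_mul_le_sqrt.
Qed.

Lemma Re_trace_mul_norm_le m n (A : 'M[C]_(m, n)) (B : 'M[C]_(n, m)) :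
  `|complex.Re (\tr (A *m B))| <= Num.sqrt (hs2 A) * Num.sqrt (hs2 B).
Proof.
rewrite ler_norml Re_trace_mul_le andbT lerNl -ReN -raddfN /= -mulNmx.
suff <- : hs2 (- A) = hs2 A by apply: Re_trace_mul_le.
by apply: eq_bigr => -[[i j] []] _; rewrite /= mxE; case: (A i j) => a b /=;
  rewrite sqrrN.
Qed.

(** * Real diagonal matrices and their unitary conjugates *)

Definition rdiag n (f : 'I_n -> R) : 'M[C]_n :=
  locked_with hs_key (diag_mx (\row_i ((f i)%:C)%C)).

Lemma rdiag_def n (f : 'I_n -> R) : rdiag f = diag_mx (\row_i ((f i)%:C)%C).
Proof. exact: locked_withE. Qed.

Lemma rdiagE n (f : 'I_n -> R) i j : rdiag f i j = ((f i)%:C)%C *+ (i == j).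
Proof. by rewrite rdiag_def !mxE. Qed.

Lemma rdiagM n (f g : 'I_n -> R) :
  rdiag f *m rdiag g = rdiag (fun i => f i * g i).
Proof.
rewrite !rdiag_def mulmx_diag; congr diag_mx; apply/rowP => i.
by rewrite !mxE -rmorphM.
Qed.

Lemma eq_rdiag n (f g : 'I_n -> R) : f =1 g -> rdiag f = rdiag g.
Proof.
move=> fg; rewrite !rdiag_def; congr diag_mx.
by apply/rowP => i; rewrite !mxE fg.
Qed.

Lemma rdiagD n (f g : 'I_n -> R) :
  rdiag f + rdiag g = rdiag (fun i => f i + g i).
Proof.
by apply/matrixP => i j; rewrite mxE !rdiagE -mulrnDl -rmorphD.
Qed.

Lemma rdiag1 n : rdiag (fun _ : 'I_n => 1) = 1%:M.
Proof. by apply/matrixP => i j; rewrite rdiagE mxE. Qed.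

Lemma rdiag_adj n (f : 'I_n -> R) : adj (rdiag f) = rdiag f.
Proof.
apply/matrixP => i j; rewrite adjE !rdiagE eq_sym; case: eqP => [->|_].
  by rewrite !mulr1n; apply: conjc_real.
by rewrite !mulr0n rmorph0.
Qed.

Lemma rdiag_mulE n m (f : 'I_n -> R) (A : 'M[C]_(n, m)) i j :
  (rdiag f *m A) i j = ((f i)%:C)%C * A i j.
Proof. by rewrite rdiag_def mul_diag_mx !mxE. Qed.

Lemma mul_rdiagE n m (f : 'I_n -> R) (A : 'M[C]_(m, n)) i j :
  (A *m rdiag f) i j = A i j * ((f j)%:C)%C.
Proof. by rewrite rdiag_def mul_mx_diag !mxE. Qed.

Lemma trace_rdiag n (f : 'I_n -> R) : complex.Re (\tr (rdiag f)) = \sum_i f i.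
Proof.
by rewrite Re_sum; apply: eq_bigr => i _; rewrite rdiagE eqxx mulr1n.
Qed.

Lemma hs2_rdiag_mul n m (f : 'I_n -> R) (A : 'M[C]_(n, m)) :
  hs2 (rdiag f *m A) = \sum_i f i ^+ 2 * complex.Re ((A *m adj A) i i).
Proof.
rewrite hs2_sum; apply: eq_bigr => i _; rewrite mxE Re_sum big_distrr /=.
apply: eq_bigr => j _; rewrite rdiag_mulE adjE.
case: (A i j) => a b /=; ring.
Qed.

Lemma hs2_rdiag n (f : 'I_n -> R) : hs2 (rdiag f) = \sum_i f i ^+ 2.
Proof.
rewrite hs2_trace rdiag_adj rdiagM trace_rdiag.
by apply: eq_bigr => i _; rewrite expr2.
Qed.

Lemma hs2_rdiag_contract n m (f : 'I_n -> R) (A : 'M[C]_(n, m)) :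
  (forall i, f i ^+ 2 <= 1) -> hs2 (rdiag f *m A) <= hs2 A.
Proof.
move=> f1; rewrite hs2_rdiag_mul hs2_diag; apply: ler_sum => i _.
apply: ler_piMl => //; rewrite mxE Re_sum; apply: sumr_ge0 => j _.
by rewrite adjE; apply: ge0_Re; apply: mul_conjC_ge0.
Qed.

Definition rconj n (V : 'M[C]_n) (f : 'I_n -> R) : 'M[C]_n :=
  locked_with hs_key (adj V *m rdiag f *m V).

Lemma rconjE n (V : 'M[C]_n) f : rconj V f = adj V *m rdiag f *m V.
Proof. exact: locked_withE. Qed.

Lemma rconj_adj n (V : 'M[C]_n) f : adj (rconj V f) = rconj V f.
Proof. by rewrite !rconjE !adjM adjK rdiag_adj mulmxA. Qed.

Lemma rconjD n (V : 'M[C]_n) f g :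
  rconj V f + rconj V g = rconj V (fun i => f i + g i).
Proof. by rewrite !rconjE -mulmxDl -mulmxDr rdiagD. Qed.

Lemma rconjM n (V : 'M[C]_n) f g : unitary V ->
  rconj V f *m rconj V g = rconj V (fun i => f i * g i).
Proof.
move=> uV; rewrite !rconjE -rdiagM !mulmxA.
by rewrite -(mulmxA _ V (adj V)) uV mulmx1.
Qed.

Lemma eq_rconj n (V : 'M[C]_n) f g : f =1 g -> rconj V f = rconj V g.
Proof. by move=> fg; rewrite !rconjE (eq_rdiag fg). Qed.

Lemma trace_rconj n (V : 'M[C]_n) f : unitary V ->
  complex.Re (\tr (rconj V f)) = \sum_i f i.
Proof.
by move=> uV; rewrite rconjE mxtrace_mulC mulmxA uV mul1mx trace_rdiag.
Qed.

Lemma hs2_rconj n (V : 'M[C]_n) f : unitary V ->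
  hs2 (rconj V f) = \sum_i f i ^+ 2.
Proof.
move=> uV; rewrite !rconjE hs2_mul_unitary // (hs2_unitary_mul _ (adj_unitary uV)).
exact: hs2_rdiag.
Qed.

(** When [f] is an indicator and [A *m adj A] a state, the right side is the probability of the
    selected outcomes for a measurement in the basis [V]. *)
Lemma hs2_rconj_mul n m (V : 'M[C]_n) f (A : 'M[C]_(n, m)) : unitary V ->
  hs2 (rconj V f *m A)
    = \sum_i f i ^+ 2 * complex.Re ((V *m (A *m adj A) *m adj V) i i).
Proof.
move=> uV; rewrite !rconjE -!mulmxA (hs2_unitary_mul _ (adj_unitary uV)).
by rewrite hs2_rdiag_mul adjM !mulmxA.
Qed.

Lemma hs2_rconj_contract n m (V : 'M[C]_n) f (A : 'M[C]_(n, m)) :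
  unitary V -> (forall i, f i ^+ 2 <= 1) -> hs2 (rconj V f *m A) <= hs2 A.
Proof.
move=> uV f1; rewrite !rconjE -!mulmxA (hs2_unitary_mul _ (adj_unitary uV)).
by rewrite (le_trans (hs2_rdiag_contract _ f1)) // hs2_unitary_mul.
Qed.

(** * Spectral calculus, positivity and polar decomposition *)

Definition psd n (A : 'M[C]_n) : Prop :=
  forall v : 'rV[C]_n, 0 <= (v *m A *m adj v) 0 0.

Definition eigval n (A : 'M[C]_n) (i : 'I_n) : R :=
  complex.Re (spectral_diag A 0 i).

Lemma spectral_diagE n (A : 'M[C]_n) : A \is hermsymmx ->
  spectral_diag A = \row_i ((eigval A i)%:C)%C.
Proof.
move=> hA; apply/rowP => i; rewrite mxE /eigval RRe_real //.
by have /mxOverP := hermitian_spectral_diag_real hA; apply.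
Qed.

Lemma mxfunE n (f : R -> R) (A : 'M[C]_n) :
  mxfun f A = rconj (spectralmx A) (f \o eigval A).
Proof.
rewrite /mxfun rconjE rdiag_def invmx_spectral.
by congr (_ *m diag_mx _ *m _); apply/rowP => i; rewrite !mxE.
Qed.

Lemma herm_spectral n (A : 'M[C]_n) : A \is hermsymmx ->
  A = rconj (spectralmx A) (eigval A).
Proof.
move=> hA; rewrite rconjE rdiag_def -invmx_spectral -(spectral_diagE hA).
exact/orthomx_spectralP/hermitian_normalmx.
Qed.

Lemma unitary_conj_rconj n (V : 'M[C]_n) f : unitary V ->
  V *m rconj V f *m adj V = rdiag f.
Proof.
move=> uV; rewrite !rconjE !mulmxA uV mul1mx -mulmxA.
by rewrite uV mulmx1.
Qed.

Lemma psd_diag_ge0 n (A V : 'M[C]_n) i : psd A -> 0 <= (V *m A *m adj V) i i.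
Proof.
move=> /(_ (row i V)); congr (0 <= _).
rewrite -!row_mul !mxE; apply: eq_bigr => j _.
by rewrite !adjE !mxE.
Qed.

Lemma psd_eigval_ge0 n (A : 'M[C]_n) i : A \is hermsymmx -> psd A ->
  0 <= eigval A i.
Proof.
move=> hA pA; have := psd_diag_ge0 (spectralmx A) i pA.
rewrite {2}(herm_spectral hA) (unitary_conj_rconj _ (spectral_unitary A)).
by rewrite rdiagE eqxx mulr1n ler0c.
Qed.

Lemma adj_mul_herm n (A : 'M[C]_n) : adj A *m A \is hermsymmx.
Proof.
apply/is_hermitianmxP; rewrite expr0 scale1r.
by rewrite -adj_def adjM adjK.
Qed.

Lemma adj_mul_psd n (A : 'M[C]_n) : psd (adj A *m A).
Proof.
move=> v; rewrite !mulmxA -mulmxA.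
have -> : A *m adj v = adj (v *m adj A) by rewrite adjM adjK.
rewrite mxE; apply: sumr_ge0 => i _; by rewrite adjE; apply: mul_conjC_ge0.
Qed.

(** Operator norm at most 1, expressed through the Hilbert-Schmidt norm so that it feeds directly
    into Cauchy-Schwarz. *)
Definition contraction n (U : 'M[C]_n) : Prop :=
  forall m (A : 'M[C]_(m, n)), hs2 (A *m U) <= hs2 A.

(* U is the adjoint of the partial isometry of the polar decomposition of A. *)
Lemma trnorm_contraction n (A : 'M[C]_n) :
  exists2 U : 'M[C]_n, contraction U & trnorm A = complex.Re (\tr (A *m U)).
Proof.
set H := adj A *m A; pose S := spectralmx H.
have hH : H \is hermsymmx := adj_mul_herm A.
have HE : adj A *m A = rconj S (eigval H) := herm_spectral hH.
have uS : unitary S by apply: spectral_unitary.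
have ev0 i : 0 <= eigval H i by apply: psd_eigval_ge0 => //; apply: adj_mul_psd.
(* As the inverse of 0 is 0, this is the spectrum of the pseudo-inverse of [|A|]. *)
pose g i := (Num.sqrt (eigval H i))^-1.
have gE i : g i * eigval H i = Num.sqrt (eigval H i).
  rewrite /g; have [->|nz] := eqVneq (eigval H i) 0; first by rewrite sqrtr0 mulr0.
  rewrite -{2}(sqr_sqrtr (ev0 i)) expr2 mulrA mulVf ?mul1r //.
  by rewrite sqrtr_eq0 -ltNge lt_def nz ev0.
exists (rconj S g *m adj A).
  move=> m B.
  (* [h] is the indicator of the nonzero eigenvalues; [U *m adj U] turns out to be the projection
     onto the support of [|A|]. *)
  pose h i : R := Num.sqrt (eigval H i) * g i.
  have h1 i : h i ^+ 2 <= 1.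
    rewrite /h /g; have [->|nz] := eqVneq (Num.sqrt (eigval H i)) 0.
      by rewrite mul0r expr0n.
    by rewrite divff // expr1n.
  have hh i : h i * h i = h i.
    rewrite /h /g; have [->|nz] := eqVneq (Num.sqrt (eigval H i)) 0.
      by rewrite !mul0r.
    by rewrite divff // mulr1.
  have UU : rconj S g *m adj A *m adj (rconj S g *m adj A) =
            rconj S h *m rconj S h.
    rewrite adjM adjK rconj_adj (mulmxA _ A (rconj S g)).
    rewrite -(mulmxA (rconj S g) (adj A) A) HE !(rconjM _ _ uS).
    by apply: eq_rconj => i; rewrite gE hh.
  rewrite hs2_trace adjM mulmxA -(mulmxA B) UU mulmxA.
  have -> : B *m rconj S h *m rconj S h *m adj B =
            adj (rconj S h *m adj B) *m (rconj S h *m adj B).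
    by rewrite adjM rconj_adj adjK mulmxA.
  rewrite -{2}[rconj S h *m adj B]adjK -hs2_trace hs2_adj -(hs2_adj B).
  exact: hs2_rconj_contract.
rewrite /trnorm -adj_def -/H mxfunE -/S (mxtrace_mulC A).
rewrite -(mulmxA (rconj S g) (adj A) A) HE (rconjM _ _ uS).
 congr (complex.Re (\tr _)).
by apply: eq_rconj => i; rewrite gE.
Qed.

Lemma trnorm_ge0 n (A : 'M[C]_n) : 0 <= trnorm A.
Proof.
rewrite /trnorm mxfunE trace_rconj; last exact: spectral_unitary.
by apply: sumr_ge0 => i _; apply: sqrtr_ge0.
Qed.

End HilbertSchmidt.

(** * One-shot covering *)

Section Empirical.
Variables (R : realFieldType) (Y : finType) (M : nat) (f : {ffun 'I_M -> Y}).

(** Used twice: as the law of a uniformly chosen codeword, and as the type of a word. *)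
Definition empirical : {ffun Y -> R} :=
  [ffun y => M%:R^-1 * #|[pred i | f i == y]|%:R].

Lemma sum_empirical (g : Y -> R) :
  \sum_y empirical y * g y = M%:R^-1 * \sum_i g (f i).
Proof.
rewrite (partition_big f predT) //= big_distrr /=; apply: eq_bigr => y _.
rewrite ffunE -mulrA; congr (_ * _).
rewrite (eq_bigr (fun=> g y)); last by move=> i /eqP ->.
by rewrite sumr_const mulr_natl.
Qed.

Lemma empirical_ge0 y : 0 <= empirical y.
Proof. by rewrite ffunE mulr_ge0 ?invr_ge0. Qed.

Lemma empirical_sum1 : (0 < M)%N -> \sum_y empirical y = 1.
Proof.
move=> M0; have := sum_empirical (fun=> 1).
under eq_bigr do rewrite mulr1.
by move=> ->; rewrite sumr_const card_ord mulVf // pnatr_eq0 -lt0n.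
Qed.

End Empirical.

Section OneShot.
Variable R : realType.
Local Notation C := (R[i]).
Local Open Scope sesquilinear_scope.

(** [L] is a square root of the positive matrix; its squared Hilbert-Schmidt norm is the trace of
    that matrix. *)
Lemma rconj_factor n (V : 'M[C]_n) (l : 'I_n -> R) :
  unitary V -> (forall i, 0 <= l i) ->
  exists2 L : 'M[C]_n, L *m adj L = rconj V l & hs2 L = \sum_i l i.
Proof.
move=> uV l0; exists (adj V *m rdiag (fun i => Num.sqrt (l i))).
  rewrite adjM adjK rdiag_adj !rconjE mulmxA -(mulmxA (adj V)) rdiagM.
  by congr (_ *m _ *m _); apply: eq_rdiag => i; rewrite -expr2 sqr_sqrtr.
rewrite (hs2_unitary_mul _ (adj_unitary uV)) hs2_rdiag.
by apply: eq_bigr => i _; rewrite sqr_sqrtr.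
Qed.

(** Cauchy-Schwarz for the factors [G *m L] and [adj L *m U]. *)
Lemma Re_trace_contract_le n (G L U : 'M[C]_n) : contraction U ->
  `|complex.Re (\tr (G *m (L *m adj L) *m U))|
    <= Num.sqrt (hs2 (G *m L)) * Num.sqrt (hs2 L).
Proof.
move=> cU; rewrite !mulmxA -mulmxA.
apply: le_trans (Re_trace_mul_norm_le _ _) _.
rewrite ler_wpM2l ?sqrtr_ge0 // ler_wsqrtr // (le_trans (cU _ _)) //.
by rewrite hs2_adj.
Qed.

Lemma rconj1 n (V : 'M[C]_n) (g : 'I_n -> R) : unitary V ->
  (forall i, g i = 1) -> rconj V g = 1%:M.
Proof.
move=> uV g1; rewrite rconjE (eq_rdiag (g := fun=> 1)) // rdiag1 mulmx1.
exact: unitary_adj_mul.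
Qed.

Lemma indicator_sqr_le1 (b : bool) : (b%:R : R) ^+ 2 <= 1.
Proof. by case: b; rewrite ?expr1n ?expr0n. Qed.

(** [cl] sorts the labels into classes. The basis [F t] and its cut-off [G t] depend on the class
    alone, so the projection can be pulled out of a sum over one class; the eigenbasis [V y] and the
    cut-off [J y] may vary with the label. *)
Variables (N : nat) (Y T : finType) (cl : Y -> T).
Variables (W V : Y -> 'M[C]_N) (lam : Y -> 'I_N -> R) (J : Y -> pred 'I_N).
Variables (F : T -> 'M[C]_N) (G : T -> pred 'I_N) (e K : R).
Hypothesis V_unitary : forall y, unitary (V y).
Hypothesis F_unitary : forall t, unitary (F t).
Hypothesis lam_ge0 : forall y j, 0 <= lam y j.
Hypothesis lam_sum1 : forall y, \sum_j lam y j = 1.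
Hypothesis W_spectral : forall y, W y = rconj (V y) (lam y).
Hypothesis J_tail : forall y, \sum_(j | ~~ J y j) lam y j <= e.
Hypothesis G_tail : forall y, \sum_(k | ~~ G (cl y) k)
  complex.Re ((F (cl y) *m W y *m adj (F (cl y))) k k) <= e.
Hypothesis JG_size : forall y,
  #|G (cl y)|%:R * \sum_(j | J y j) lam y j ^+ 2 <= K.

Let proj t := rconj (F t) (fun k => (G t k)%:R).
Let coproj t := rconj (F t) (fun k => (~~ G t k)%:R).
Let smooth y := rconj (V y) (fun j => lam y j * (J y j)%:R).
Let rough y := rconj (V y) (fun j => lam y j * (~~ J y j)%:R).

(** The projection multiplies on the left only, so the splitting is exact. The first two terms are
    errors, the third is what the codebook has to reproduce. *)
Let W_split y :
  W y = coproj (cl y) *m W y + proj (cl y) *m rough y + proj (cl y) *m smooth y.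
Proof.
have -> : coproj (cl y) *m W y + proj (cl y) *m rough y + proj (cl y) *m smooth y
    = coproj (cl y) *m W y + proj (cl y) *m (rough y + smooth y).
  by rewrite mulmxDr addrA.
have -> : rough y + smooth y = W y.
  rewrite rconjD W_spectral; apply: eq_rconj => j.
  by case: (J y j); rewrite /= ?mulr0 ?mulr1 ?add0r ?addr0.
rewrite -mulmxDl rconjD rconj1 ?mul1mx // => k.
by case: (G _ k); rewrite /= ?add0r ?addr0.
Qed.

(** Of the two square-root factors of [W y] only one meets the projection; the other has norm 1,
    whence [Num.sqrt e]. In [rough_tail] both factors are small and the bound is [e]. *)
Let coproj_tail y (U : 'M[C]_N) : contraction U ->
  `|complex.Re (\tr (coproj (cl y) *m W y *m U))| <= Num.sqrt e.
Proof.
move=> cU; have [L LE hL] := rconj_factor (V_unitary y) (lam_ge0 y).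
rewrite -W_spectral in LE; rewrite -{1}LE.
apply: le_trans (Re_trace_contract_le _ _ cU) _.
rewrite hL lam_sum1 sqrtr1 mulr1 ler_wsqrtr // hs2_rconj_mul // LE.
apply: le_trans (G_tail y); rewrite [leRHS]big_mkcond /=; apply: ler_sum => k _.
by case: (G _ k); rewrite /= ?expr0n ?mul0r ?expr1n ?mul1r.
Qed.

Let rough_tail y (U : 'M[C]_N) : contraction U ->
  `|complex.Re (\tr (proj (cl y) *m rough y *m U))| <= e.
Proof.
move=> cU.
have l0 j : 0 <= lam y j * (~~ J y j)%:R by rewrite mulr_ge0.
have [L LE hL] := rconj_factor (V_unitary y) l0.
rewrite /rough -LE.
apply: le_trans (Re_trace_contract_le _ _ cU) _.
apply: (@le_trans _ _ (Num.sqrt (hs2 L) * Num.sqrt (hs2 L))).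
  rewrite ler_wpM2r ?sqrtr_ge0 // ler_wsqrtr //.
  by apply: hs2_rconj_contract => // k; apply: indicator_sqr_le1.
rewrite -expr2 sqr_sqrtr ?hs2_ge0 // hL.
apply: le_trans (J_tail y); rewrite [leRHS]big_mkcond /=; apply: ler_sum => j _.
by case: (J y j); rewrite /= ?mulr0 ?mulr1.
Qed.

(** The squared Hilbert-Schmidt norm of a projection is its rank. *)
Let proj_bound t (D U : 'M[C]_N) : contraction U ->
  complex.Re (\tr (proj t *m D *m U)) <= Num.sqrt (#|G t|%:R * hs2 D).
Proof.
move=> cU; rewrite -mulmxA (le_trans (Re_trace_mul_le _ _)) //.
have -> : hs2 (proj t) = #|G t|%:R.
  rewrite hs2_rconj // -sum1_card natr_sum [in RHS]big_mkcond /=.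
  by apply: eq_bigr => k _; rewrite -topredE /=; case: (G t k);
    rewrite ?expr1n ?expr0n.
by rewrite sqrtrM // ler_wpM2l ?sqrtr_ge0 // ler_wsqrtr.
Qed.

(** One codebook serves all classes at once: it controls the sum over classes of rank times squared
    Hilbert-Schmidt error, hence each summand. *)
Lemma oneshot_covering (p : {ffun Y -> R}) (M : nat) : is_distr p -> (0 < M)%N ->
  exists q : {ffun Y -> R},
    [/\ is_distr q, forall y, exists z : int, M%:R * q y = z%:~R &
      trnorm (\sum_y ((p y)%:C)%C *: W y - \sum_y ((q y)%:C)%C *: W y)
        <= 2 * (Num.sqrt e + e) + #|T|%:R * Num.sqrt (K / M%:R)].
Proof.
move=> [p0 p1] M0.
pose Cd := ('I_N * 'I_N * bool)%type.
pose w (te : T * Cd) : R := #|G te.1|%:R.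
(* The real coordinates of all class blocks are stacked into one index; a label contributes to the
   block of its own class only. *)
pose b (te : T * Cd) y : R :=
  (cl y == te.1)%:R * cpart te.2.2 (smooth y te.2.1.1 te.2.1.2).
have w0 te : 0 <= w te by rewrite /w.
have [f fP] := exists_codebook b p0 p1 w0 M0.
pose q := empirical R f.
have q_distr : is_distr q.
  by split; [exact: empirical_ge0 | exact: empirical_sum1].
exists q; split => // [y|].
  exists #|[pred i | f i == y]|%:Z; rewrite ffunE mulrA mulfV ?mul1r //.
  by rewrite pnatr_eq0 -lt0n.
pose c y := p y - q y.
pose D t := \sum_(y | cl y == t) ((c y)%:C)%C *: smooth y.
have wD te : \sum_y p y * b te y - M%:R^-1 * \sum_i b te (f i) =
    cpart te.2.2 (D te.1 te.2.1.1 te.2.1.2).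
  rewrite -sum_empirical -sumrB /D summxE cpart_sum [in RHS]big_mkcond /=.
  apply: eq_bigr => y _; rewrite -mulrBl -/(c y) /b.
  by case: eqP => _; rewrite ?mul0r ?mulr0 // mul1r mxE cpart_mulr_real.
have sumD : \sum_t #|G t|%:R * hs2 (D t) <= K / M%:R.
  under eq_bigr do rewrite /hs2 big_distrr /=.
  rewrite pair_big /=; under eq_bigr => te _ do rewrite -wD.
  apply: le_trans fP _; rewrite mulrC ler_wpM2r ?invr_ge0 //.
  under eq_bigr do rewrite big_distrr /=.
  rewrite exchange_big /=; apply: (@le_trans _ _ (\sum_y p y * K)); last first.
    by rewrite -mulr_suml p1 mul1r.
  apply: ler_sum => y _; under eq_bigr do rewrite mulrCA.
  rewrite -mulr_sumr ler_wpM2l //.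
  apply: le_trans (JG_size y).
  rewrite -(pair_big predT predT (fun t ce => w (t, ce) * b (t, ce) y ^+ 2)) /=.
  rewrite (bigD1 (cl y)) //= [X in _ + X]big1 ?addr0; last first.
    by move=> t nt; rewrite big1 // => ce _; rewrite /b /= eq_sym (negPf nt)
      mul0r expr0n mulr0.
  rewrite /w /= -mulr_sumr ler_wpM2l //.
  have -> : \sum_i b (cl y, i) y ^+ 2 = hs2 (smooth y).
    by apply: eq_bigr => ce _; rewrite /b /= eqxx mul1r.
  rewrite hs2_rconj // [leRHS]big_mkcond /=; apply: ler_sum => j _.
  by case: (J y j); rewrite /= ?mulr0 ?mulr1 ?expr0n.
(* [U] depends on the chosen codebook, which is harmless: the tail bounds hold for every
   contraction. *)
have [U cU ->] := trnorm_contraction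
  (\sum_y ((p y)%:C)%C *: W y - \sum_y ((q y)%:C)%C *: W y).
have -> : \sum_y ((p y)%:C)%C *: W y - \sum_y ((q y)%:C)%C *: W y =
    \sum_y ((c y)%:C)%C *: W y.
  by rewrite -sumrB; apply: eq_bigr => y _; rewrite -scalerBl -rmorphB.
have ReZ (a : R) (A : 'M[C]_N) :
    complex.Re (\tr ((a%:C)%C *: A *m U)) = a * complex.Re (\tr (A *m U)).
  by rewrite -scalemxAl mxtraceZ Re_mulr_real.
have Re_sumZ (P : pred Y) (a : Y -> R) (A : Y -> 'M[C]_N) :
    complex.Re (\tr ((\sum_(y | P y) ((a y)%:C)%C *: A y) *m U)) =
    \sum_(y | P y) a y * complex.Re (\tr (A y *m U)).
  rewrite mulmx_suml (big_morph _ (@mxtraceD _ N) (mxtrace0 _ N)) Re_sum.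
  by apply: eq_bigr => y _; apply: ReZ.
rewrite Re_sumZ.
have -> : \sum_y c y * complex.Re (\tr (W y *m U)) =
   \sum_y c y * (complex.Re (\tr (coproj (cl y) *m W y *m U))
                 + complex.Re (\tr (proj (cl y) *m rough y *m U)))
   + \sum_t complex.Re (\tr (proj t *m D t *m U)).
  have -> : \sum_t complex.Re (\tr (proj t *m D t *m U)) =
      \sum_y c y * complex.Re (\tr (proj (cl y) *m smooth y *m U)).
    rewrite [RHS](partition_big cl predT) //=; apply: eq_bigr => t _.
    have -> : proj t *m D t =
        \sum_(y | cl y == t) ((c y)%:C)%C *: (proj t *m smooth y).
      by rewrite /D mulmx_sumr; apply: eq_bigr => y _; rewrite -scalemxAr.
    by rewrite Re_sumZ; apply: eq_bigr => y /eqP ->.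
  rewrite -big_split /=; apply: eq_bigr => y _; rewrite -mulrDr; congr (_ * _).
  by rewrite {1}W_split !mulmxDl !mxtraceD !ReD.
apply: lerD.
  (* The tails are paid separately under [p] and under [q], of total mass 2. *)
  apply: (@le_trans _ _ (\sum_y (p y + q y) * (Num.sqrt e + e))); last first.
    rewrite -mulr_suml big_split /= p1 (proj2 q_distr); lra.
  apply: ler_sum => y _; apply: le_trans (ler_norm _) _; rewrite normrM.
  apply: ler_pM => //.
    have := p0 y; have := proj1 q_distr y; rewrite /c => ? ?.
    by rewrite ler_norml; apply/andP; split; lra.
  apply: le_trans (ler_normD _ _) _.
  by apply: lerD; [apply: coproj_tail | apply: rough_tail].
apply: (@le_trans _ _ (\sum_(t : T) Num.sqrt (K / M%:R))); last first.
  by rewrite sumr_const mulr_natl.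
apply: ler_sum => t _; apply: le_trans (proj_bound _ _ cU) _.
rewrite ler_wsqrtr // (le_trans _ sumD) // (bigD1 t) //= lerDl.
by apply: sumr_ge0 => t' _; rewrite mulr_ge0 ?hs2_ge0.
Qed.

End OneShot.

(** * Typical words, tensor powers and density matrices *)

Section Log2.
Variable R : realType.
Implicit Types s x : R.

Lemma ln2_gt0 : 0 < ln 2 :> R.
Proof. by apply: ln_gt0; rewrite ltr1n. Qed.

Lemma powR_log2 s : 0 < s -> 2 `^ log2 s = s.
Proof.
move=> s0; rewrite /log2 s0 /powR pnatr_eq0 /= divfK ?lnK //.
by rewrite gt_eqF // ln2_gt0.
Qed.

Lemma powR2_le (x y : R) : (2 `^ x <= 2 `^ y) = (x <= y).
Proof. by rewrite /powR pnatr_eq0 /= ler_expR ler_pM2r ?ln2_gt0. Qed.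

Lemma powR2D (x y : R) : 2 `^ (x + y) = 2 `^ x * 2 `^ y :> R.
Proof. by rewrite powRD // pnatr_eq0 implybT. Qed.

(** With [u = ln s], squaring [- u / 2 <= expR (- u / 2)] gives [u ^+ 2 / 4 <= s^-1]. *)
Lemma log2_sqr_le s : 0 <= s <= 1 -> s * log2 s ^+ 2 <= 4 / ln 2 ^+ 2.
Proof.
move=> /andP[s0 s1]; rewrite /log2; case: ifPn => [sp|_]; last first.
  by rewrite expr0n mulr0 divr_ge0 // exprn_ge0 // ltW // ln2_gt0.
rewrite exprMn exprVn mulrA ler_wpM2r ?invr_ge0 ?exprn_ge0 ?(ltW ln2_gt0) //.
set u := ln s; have u0 : u <= 0 by rewrite ln_le0.
have h : - u / 2 <= expR (- u / 2).
  by apply: le_trans (expR_ge1Dx _); rewrite lerDr.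
have us : expR (- u / 2) ^+ 2 = s^-1.
  have e2 : - u / 2 + - u / 2 = - u by lra.
  by rewrite expr2 -expRD e2 expRN lnK.
have : (- u / 2) ^+ 2 <= s^-1.
  by rewrite -us ler_pXn2r ?nnegrE ?expR_ge0 // divr_ge0 // oppr_ge0.
move=> /(ler_wpM2l s0); rewrite divff ?gt_eqF // expr_div_n sqrrN; lra.
Qed.

Variables (I J : finType) (mu v : I -> J -> R).
Hypothesis mu_ge0 : forall i j, 0 <= mu i j.
Hypothesis mu_sum1 : forall i, \sum_j mu i j = 1.
Hypothesis v_gt0 : forall i j, mu i j != 0 -> 0 < v i j.

(** Chebyshev for the sum of [log2 (v i (k i))]. The law [mu] and the values [v] are kept apart
    because a state is also measured in the eigenbasis of another one; positivity of [v] where [mu]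
    is nonzero keeps the convention [log 0 = 0] out of play. *)
Lemma log2_prod_tail (c m : R) : 0 < c ->
  \sum_i \sum_j mu i j * log2 (v i j) = m ->
  \sum_(k : {ffun I -> J} | ~~ (2 `^ (m - c) <= \prod_i v i (k i) <= 2 `^ (m + c)))
     \prod_i mu i (k i)
  <= (\sum_i \sum_j mu i j * log2 (v i j) ^+ 2) / c ^+ 2.
Proof.
move=> c0 mE; apply: (chebyshev_prod_weight mu_sum1 mu_ge0 c0) => k Pk mk.
have vE : \prod_i v i (k i) = 2 `^ (\sum_i log2 (v i (k i))).
  rewrite (big_morph (fun x : R => 2 `^ x) powR2D (powRr0 2)).
  apply: eq_bigr => i _; rewrite powR_log2 //; apply: v_gt0.
  by move: mk => /prodf_neq0 /(_ i isT).
move: Pk; rewrite vE !powR2_le; apply: contraNT.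
by rewrite -ltNge ltr_norml mE => /andP[? ?]; apply/andP; split; lra.
Qed.

End Log2.

(** * Tensor products indexed by words *)

Section Tensor.
Variables (R : realType) (d n : nat).
Local Notation C := (R[i]).
Local Notation word := (word_ty d n).
Local Notation ev := (@enum_val word predT).

Lemma sum_enum_val (V : nmodType) (P : pred word) (g : word -> V) :
  \sum_(a : 'I_#|word| | P (ev a)) g (ev a) = \sum_(w | P w) g w.
Proof.
rewrite (reindex (@enum_rank word)) /=.
  by apply: eq_big => [w|w _]; rewrite enum_rankK.
by exists ev => a _; rewrite ?enum_rankK ?enum_valK.
Qed.

(** Extends [tensW] to arbitrary factors, so that eigenbases and diagonal matrices can be tensored
    too. *)
Definition tens (A : 'I_n -> 'M[C]_d) : 'M[C]_#|word| :=
  locked_with hs_key (\matrix_(a, b) \prod_(k < n) A k (ev a k) (ev b k)).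

Lemma tensE (A : 'I_n -> 'M[C]_d) a b :
  tens A a b = \prod_(k < n) A k (ev a k) (ev b k).
Proof. by rewrite /tens locked_withE mxE. Qed.

Lemma eq_tens (A B : 'I_n -> 'M[C]_d) : A =1 B -> tens A = tens B.
Proof.
move=> AB; apply/matrixP => a b; rewrite !tensE.
by apply: eq_bigr => k _; rewrite AB.
Qed.

Lemma tensM (A B : 'I_n -> 'M[C]_d) :
  tens A *m tens B = tens (fun k => A k *m B k).
Proof.
apply/matrixP => a b; rewrite mxE tensE.
under eq_bigr do rewrite !tensE -big_split /=.
rewrite (sum_enum_val predT
  (fun w : word => \prod_(k < n) (A k (ev a k) (w k) * B k (w k) (ev b k)))).
rewrite -(bigA_distr_bigA (fun k j => A k (ev a k) j * B k j (ev b k))).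
by apply: eq_bigr => k _; rewrite mxE.
Qed.

Lemma tens_adj (A : 'I_n -> 'M[C]_d) : adj (tens A) = tens (fun k => adj (A k)).
Proof.
apply/matrixP => a b; rewrite adjE !tensE rmorph_prod.
by apply: eq_bigr => k _; rewrite adjE.
Qed.

Lemma tens_rdiag (f : 'I_n -> 'I_d -> R) :
  tens (fun k => rdiag (f k)) = rdiag (fun a => \prod_k f k (ev a k)).
Proof.
apply/matrixP => a b; rewrite tensE rdiagE.
case: eqP => [->|ab].
  by rewrite mulr1n rmorph_prod; apply: eq_bigr => k _; rewrite rdiagE eqxx mulr1n.
(* Distinct words differ at some letter, and the diagonal factor there vanishes. *)
rewrite mulr0n; have [k kab] : exists k, ev a k != ev b k.
  apply/existsP; rewrite -negb_forall; apply/negP => /forallP h; apply: ab.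
  by apply: enum_val_inj; apply/ffunP => k; apply/eqP.
by rewrite (bigD1 k) //= rdiagE (negPf kab) mulr0n mul0r.
Qed.

Lemma tens_rconj (V : 'I_n -> 'M[C]_d) (f : 'I_n -> 'I_d -> R) :
  tens (fun k => rconj (V k) (f k)) =
  rconj (tens V) (fun a => \prod_k f k (ev a k)).
Proof.
rewrite rconjE tens_adj -tens_rdiag !tensM; apply: eq_tens => k.
exact: rconjE.
Qed.

Lemma tens_unitary (V : 'I_n -> 'M[C]_d) :
  (forall k, unitary (V k)) -> unitary (tens V).
Proof.
move=> uV; rewrite /unitary tens_adj tensM -rdiag1.
rewrite (eq_tens (B := fun k => rdiag (fun=> 1))); last first.
  by move=> k; rewrite uV rdiag1.
by rewrite tens_rdiag; apply: eq_rdiag => a; rewrite big1.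
Qed.

End Tensor.

(** * Density matrices, measured laws and mutual information *)

Section Density.
Variables (R : realType) (X : finType) (d : nat) (W : X -> 'M[R[i]]_d).
Local Notation C := (R[i]).
Hypothesis W_density : forall x, density (W x).

Lemma density_herm (A : 'M[C]_d) : density A -> A \is hermsymmx.
Proof. by case. Qed.

Lemma density_psd (A : 'M[C]_d) : density A -> psd A.
Proof. by move=> [_ [h _]] v; rewrite adj_def. Qed.

Lemma density_eigval_ge0 (A : 'M[C]_d) j : density A -> 0 <= eigval A j.
Proof.
by move=> dA; apply: psd_eigval_ge0; [apply: density_herm|apply: density_psd].
Qed.

Lemma density_eigval_sum1 (A : 'M[C]_d) : density A -> \sum_j eigval A j = 1.
Proof.
move=> dA; rewrite -(trace_rconj _ (spectral_unitary A)).
rewrite -(herm_spectral (density_herm dA)).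
by case: dA => _ [_ ->].
Qed.

Lemma density_eigval_le1 (A : 'M[C]_d) j : density A -> eigval A j <= 1.
Proof.
move=> dA; rewrite -(density_eigval_sum1 dA) (bigD1 j) //= lerDl.
by apply: sumr_ge0 => i _; apply: density_eigval_ge0.
Qed.

Lemma avg_density (p : {ffun X -> R}) : is_distr p -> density (avg W p).
Proof.
move=> [p0 p1]; split; [|split].
- apply/is_hermitianmxP; rewrite expr0 scale1r -adj_def /avg.
  apply/matrixP => i j; rewrite adjE !summxE rmorph_sum; apply: eq_bigr => x _.
  rewrite !mxE rmorphM /=; congr (_ * _).
    by apply: esym; apply: conjc_real.
  have /is_hermitianmxP := density_herm (W_density x).
  by rewrite expr0 scale1r => {1}->; rewrite !mxE.
- move=> v; rewrite /avg mulmx_sumr mulmx_suml summxE; apply: sumr_ge0 => x _.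
  rewrite -scalemxAr -scalemxAl mxE mulr_ge0 ?ler0c //.
  by case: (W_density x) => _ [].
rewrite /avg (big_morph _ (@mxtraceD _ d) (mxtrace0 _ d)).
transitivity (\sum_x ((p x)%:C)%C : C).
  by apply: eq_bigr => x _; rewrite mxtraceZ; case: (W_density x) => _ [_ ->];
    rewrite mulr1.
by rewrite -rmorph_sum p1.
Qed.

(* The outcome distribution when [A] is measured in the eigenbasis of [B]. *)
Definition measured (A B : 'M[C]_d) (k : 'I_d) : R :=
  complex.Re ((spectralmx B *m A *m adj (spectralmx B)) k k).

Lemma measured_ge0 A B k : density A -> 0 <= measured A B k.
Proof. by move=> dA; apply/ge0_Re/psd_diag_ge0/density_psd. Qed.

Lemma measured_complexE A B k : density A ->
  (spectralmx B *m A *m adj (spectralmx B)) k k = ((measured A B k)%:C)%C.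
Proof. by move=> dA; apply/ge0_complexE/psd_diag_ge0/density_psd. Qed.

Lemma trace_mul_rconj A B (g : 'I_d -> R) :
  complex.Re (\tr (A *m rconj (spectralmx B) g)) = \sum_k measured A B k * g k.
Proof.
rewrite rconjE !mulmxA mxtrace_mulC !mulmxA Re_sum; apply: eq_bigr => k _.
rewrite mul_rdiagE mulrC Re_mulr_real mulrC; congr (_ * _).
Qed.

Lemma measured_sum1 A B : density A -> \sum_k measured A B k = 1.
Proof.
move=> dA; have := trace_mul_rconj A B (fun=> 1).
rewrite rconj1 //; last exact: spectral_unitary.
rewrite mulmx1; case: dA => _ [_ ->] /=.
by under eq_bigr do rewrite mulr1.
Qed.

Lemma measured_avg (p : {ffun X -> R}) B k :
  measured (avg W p) B k = \sum_x p x * measured (W x) B k.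
Proof.
rewrite /measured /avg mulmx_sumr mulmx_suml summxE Re_sum.
apply: eq_bigr => x _.
by rewrite -scalemxAr -scalemxAl mxE Re_mulr_real.
Qed.

Lemma measured_self (A : 'M[C]_d) k : density A -> measured A A k = eigval A k.
Proof.
move=> dA; rewrite /measured {2}(herm_spectral (density_herm dA)).
rewrite (unitary_conj_rconj _ (spectral_unitary A)).
by rewrite rdiagE eqxx mulr1n.
Qed.

(** The Holevo form, with negative entropies. The measured law is linear in the state, so the terms
    [Tr W_x log W(p)] average to [Tr W(p) log W(p)]. *)
Lemma mutinfE (p : {ffun X -> R}) : is_distr p ->
  mutinf W p =
  \sum_x p x * (\sum_j eigval (W x) j * log2 (eigval (W x) j))
  - \sum_k eigval (avg W p) k * log2 (eigval (avg W p) k).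
Proof.
move=> dp; have dr := avg_density dp.
have -> : \sum_k eigval (avg W p) k * log2 (eigval (avg W p) k) =
    \sum_x p x * \sum_k measured (W x) (avg W p) k * log2 (eigval (avg W p) k).
  under [RHS]eq_bigr do rewrite big_distrr /=.
  rewrite exchange_big /=; apply: eq_bigr => k _.
  rewrite -{1}measured_self // measured_avg big_distrl /=.
  by apply: eq_bigr => x _; rewrite mulrA.
rewrite -sumrB; apply: eq_bigr => x _; rewrite -mulrBr; congr (_ * _).
rewrite /relent mulmxBr raddfB ReD ReN /= !mxfunE !trace_mul_rconj.
congr (_ - _).
by apply: eq_bigr => j _; rewrite measured_self.
Qed.

(** A point mass at [x] yields [relent (W x) (W x) = 0]; hence the capacity is nonnegative. *)
Lemma exists_mutinf0 (x : X) :
  exists2 p : {ffun X -> R}, is_distr p & mutinf W p = 0.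
Proof.
pose p : {ffun X -> R} := [ffun z => (z == x)%:R].
have pd : is_distr p.
  split=> [z|]; first by rewrite ffunE.
  rewrite (bigD1 x) //= ffunE eqxx big1 ?addr0 // => z /negPf zx.
  by rewrite ffunE zx.
exists p => //.
have pW : avg W p = W x.
  rewrite /avg (bigD1 x) //= ffunE eqxx scale1r big1 ?addr0 // => z /negPf zx.
  by rewrite ffunE zx scale0r.
rewrite /mutinf pW; apply: big1 => z _; rewrite ffunE.
have [->|_] := eqVneq z x; last by rewrite mul0r.
by rewrite /relent subrr mulmx0 mxtrace0 mulr0.
Qed.

End Density.

(** * Covering on type classes *)

Section TypeClasses.
Variables (R : realType) (X : finType) (d : nat) (W : X -> 'M[R[i]]_d).
Local Notation C := (R[i]).
Hypothesis W_density : forall x, density (W x).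
Variables (n : nat) (dl : R).
Hypothesis n_gt0 : (0 < n)%N.
Hypothesis dl_gt0 : 0 < dl.
Local Notation word := (word_ty d n).
Local Notation ev := (@enum_val word predT).

(** Integer counts make the types a finite type with [(n+1)^|X|] elements. A count never exceeds
    [n], so [inord] does not fall back to its default. *)
Definition type_of (y : {ffun 'I_n -> X}) : {ffun X -> 'I_n.+1} :=
  [ffun x => inord #|[pred i | y i == x]|].

Definition type_distr (t : {ffun X -> 'I_n.+1}) : {ffun X -> R} :=
  [ffun x => n%:R^-1 * (t x)%:R].

Lemma type_distr_of y : type_distr (type_of y) = empirical R y.
Proof.
apply/ffunP => x; rewrite !ffunE inordK // ltnS.
by rewrite -[X in (_ <= X)%N](card_ord n) max_card.
Qed.

Lemma type_distr_distr y : is_distr (type_distr (type_of y)).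
Proof.
rewrite type_distr_of; split; [exact: empirical_ge0 | exact: empirical_sum1].
Qed.

Lemma sum_type_distr (y : {ffun 'I_n -> X}) (g : X -> R) :
  \sum_i g (y i) = n%:R * \sum_x type_distr (type_of y) x * g x.
Proof.
rewrite type_distr_of sum_empirical mulrA mulfV ?mul1r //.
by rewrite pnatr_eq0 -lt0n.
Qed.

Let rho t := avg W (type_distr t).
(** [in_ent] and [out_ent] carry no minus sign: they are negative entropies. Below, the upper edge
    of [J] bounds the purity of the truncated state and the lower edge of [G] the rank of the
    projection. *)
Let in_ent t := \sum_x type_distr t x *
  (\sum_j eigval (W x) j * log2 (eigval (W x) j)).
Let out_ent t := \sum_k eigval (rho t) k * log2 (eigval (rho t) k).
Let wid := n%:R * dl.
Let lam (y : {ffun 'I_n -> X}) (w : word) := \prod_k eigval (W (y k)) (w k).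
Let sig t (w : word) := \prod_k eigval (rho t) (w k).
Let J y (w : word) := 2 `^ (n%:R * in_ent (type_of y) - wid) <= lam y w
  <= 2 `^ (n%:R * in_ent (type_of y) + wid).
Let G t (w : word) := 2 `^ (n%:R * out_ent t - wid) <= sig t w
  <= 2 `^ (n%:R * out_ent t + wid).

(** Each of the [n] letters has second moment at most [d * 4 / (ln 2)^2]; the total is divided by
    the squared half-width [(n dl)^2]. *)
Definition tail_bound : R := d%:R * (4 / ln 2 ^+ 2) / (n%:R * dl ^+ 2).

Let wid_gt0 : 0 < wid. Proof. by rewrite mulr_gt0 ?ltr0n. Qed.

Let rho_density y : density (rho (type_of y)).
Proof. exact/(avg_density W_density)/type_distr_distr. Qed.

Let sum_log2_sqr_le (A : 'M[C]_d) : density A ->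
  \sum_j eigval A j * log2 (eigval A j) ^+ 2 <= d%:R * (4 / ln 2 ^+ 2).
Proof.
move=> dA; apply: (@le_trans _ _ (\sum_(j < d) 4 / ln 2 ^+ 2)).
  apply: ler_sum => j _; apply: log2_sqr_le.
  by rewrite density_eigval_ge0 // density_eigval_le1.
by rewrite sumr_const card_ord -[leLHS]mulr_natl.
Qed.

Let tail_le (v : R) : v <= n%:R * (d%:R * (4 / ln 2 ^+ 2)) ->
  v / wid ^+ 2 <= tail_bound.
Proof.
move=> vle.
have n0 : n%:R != 0 :> R by rewrite pnatr_eq0 -lt0n.
have dl0 : dl != 0 by rewrite gt_eqF.
have l0 : ln 2 != 0 :> R by rewrite gt_eqF // ln2_gt0.
have -> : tail_bound = (n%:R * (d%:R * (4 / ln 2 ^+ 2))) / wid ^+ 2.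
  by rewrite /tail_bound /wid; field; rewrite dl0 l0 n0.
by rewrite ler_wpM2r // invr_ge0 sqr_ge0.
Qed.

Let lam_tail y : \sum_(w | ~~ J y w) lam y w <= tail_bound.
Proof.
have l0 k j : 0 <= eigval (W (y k)) j by apply: density_eigval_ge0.
apply: le_trans (tail_le _); last first.
  apply: (@le_trans _ _ (\sum_(k < n) d%:R * (4 / ln 2 ^+ 2))).
    by apply: ler_sum => k _; apply: (sum_log2_sqr_le (W_density (y k))).
  by rewrite sumr_const card_ord -[leLHS]mulr_natl.
apply: (log2_prod_tail (mu := fun k j => eigval (W (y k)) j)) => //.
- by move=> k; apply: density_eigval_sum1.
- by move=> k j nz; rewrite lt_def nz l0.
exact: (sum_type_distr y (fun x => \sum_j eigval (W x) j * log2 (eigval (W x) j))).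
Qed.

(** The states of the letters of [y] average to [rho], whose measured law in its own eigenbasis is
    its spectrum. *)
Let sum_measured (y : {ffun 'I_n -> X}) (g : 'I_d -> R) :
  \sum_k \sum_j measured (W (y k)) (rho (type_of y)) j * g j =
  n%:R * \sum_j eigval (rho (type_of y)) j * g j.
Proof.
rewrite (sum_type_distr y (fun x => \sum_j measured (W x) (rho (type_of y)) j * g j)).
congr (_ * _); under eq_bigr do rewrite big_distrr /=.
rewrite exchange_big /=; apply: eq_bigr => j _.
rewrite -measured_self // {2}/rho measured_avg big_distrl /=.
by apply: eq_bigr => x _; rewrite mulrA.
Qed.

Let sig_tail (y : {ffun 'I_n -> X}) : \sum_(w | ~~ G (type_of y) w)
  \prod_k measured (W (y k)) (rho (type_of y)) (w k) <= tail_bound.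
Proof.
set t := type_of y.
have m0 k j : 0 <= measured (W (y k)) (rho t) j by apply: measured_ge0.
have vle : n%:R * (\sum_j eigval (rho t) j * log2 (eigval (rho t) j) ^+ 2)
    <= n%:R * (d%:R * (4 / ln 2 ^+ 2)).
  by rewrite ler_wpM2l //; apply: (sum_log2_sqr_le (rho_density y)).
apply: le_trans (tail_le vle).
rewrite -(sum_measured y (fun j => log2 (eigval (rho t) j) ^+ 2)).
apply: (log2_prod_tail (mu := fun k => measured (W (y k)) (rho t))
  (v := fun=> eigval (rho t))) => //.
- by move=> k; apply: measured_sum1.
(* The letter [y k] has positive weight in the type of [y], so an outcome possible under its state
   has a positive eigenvalue in [rho]. *)
- move=> k j nz.
  have pk : 0 < type_distr t (y k).
    rewrite type_distr_of ffunE mulr_gt0 ?invr_gt0 ?ltr0n //.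
    by apply/card_gt0P; exists k; rewrite inE.
  rewrite -measured_self; last exact: rho_density.
  rewrite {2}/rho measured_avg (bigD1 (y k)) //= ltr_pwDl //.
    by rewrite mulr_gt0 // lt_def nz m0.
  apply: sumr_ge0 => x _; rewrite mulr_ge0 ?measured_ge0 //.
  exact: (proj1 (type_distr_distr y)).
Qed.

Let sum_lam1 y : \sum_w lam y w = 1.
Proof.
apply: (sum_prod_weight1 (mu := fun k => eigval (W (y k)))).
by move=> k; apply: density_eigval_sum1.
Qed.

Let sum_lam_sqr y :
  \sum_(w | J y w) lam y w ^+ 2 <= 2 `^ (n%:R * in_ent (type_of y) + wid).
Proof.
have l0 w : 0 <= lam y w by apply: prodr_ge0 => k _; apply: density_eigval_ge0.
apply: (@le_trans _ _
  (\sum_w lam y w * 2 `^ (n%:R * in_ent (type_of y) + wid))); last first.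
  by rewrite -mulr_suml sum_lam1 mul1r.
rewrite big_mkcond; apply: ler_sum => w _; case: ifP => [/andP[_ h]|_].
  by rewrite expr2 ler_wpM2l.
by rewrite mulr_ge0 // powR_ge0.
Qed.

(** The eigenvalues of the tensor power sum to 1, and each selected one is at least the lower
    edge. *)
Let card_G y : #|G (type_of y)|%:R <= 2 `^ (- (n%:R * out_ent (type_of y) - wid)).
Proof.
set t := type_of y; set tau := n%:R * out_ent t - wid.
rewrite powRN -div1r ler_pdivlMr ?powR_gt0 //.
have sig1 : \sum_w sig t w = 1.
  apply: (sum_prod_weight1 (mu := fun=> eigval (rho t))).
  by move=> k; apply: (density_eigval_sum1 (rho_density y)).
rewrite -[leRHS]sig1.
have -> : #|G t|%:R = \sum_(w in G t) 1 :> R by rewrite sumr_const.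
rewrite mulr_suml big_mkcond; apply: ler_sum => w _.
rewrite -topredE /=; case: ifP => [/andP[h _]|_]; first by rewrite mul1r.
by apply: prodr_ge0 => k _; apply: (density_eigval_ge0 _ (rho_density y)).
Qed.

Lemma tensor_covering (r : R) (p : {ffun {ffun 'I_n -> X} -> R}) (M : nat) :
  (forall p1 : {ffun X -> R}, is_distr p1 -> mutinf W p1 <= r) ->
  is_distr p -> (0 < M)%N ->
  exists q : {ffun {ffun 'I_n -> X} -> R},
    [/\ is_distr q, forall y, exists z : int, M%:R * q y = z%:~R &
      trnorm (avgn W p - avgn W q)
        <= 2 * (Num.sqrt tail_bound + tail_bound)
           + #|{ffun X -> 'I_n.+1}|%:R *
             Num.sqrt (2 `^ (n%:R * (r + 2 * dl)) / M%:R)].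
Proof.
move=> Ir pd M0.
have tensWE (y : {ffun 'I_n -> X}) : tensW W y = tens (fun k => W (y k)).
  by apply/matrixP => a b; rewrite tensE mxE.
rewrite /avgn.
refine (@oneshot_covering R #|word| _ _ type_of (@tensW R X d W n)
  (fun y => tens (fun k => spectralmx (W (y k))))
  (fun y a => lam y (ev a)) (fun y a => J y (ev a))
  (fun t => tens (fun=> spectralmx (rho t)))
  (fun t a => G t (ev a)) tail_bound (2 `^ (n%:R * (r + 2 * dl)))
  _ _ _ _ _ _ _ _ p M pd M0).
- by move=> y; apply: tens_unitary => k; apply: spectral_unitary.
- by move=> t; apply: tens_unitary => k; apply: spectral_unitary.
- by move=> y a; apply: prodr_ge0 => k _; apply: density_eigval_ge0.
- by move=> y; rewrite (sum_enum_val predT (lam y)) sum_lam1.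
- move=> y; rewrite tensWE /lam -(tens_rconj _ (fun k => eigval (W (y k)))).
  by apply: eq_tens => k; apply/herm_spectral/density_herm.
- by move=> y; rewrite (sum_enum_val (fun w => ~~ J y w) (lam y)); apply: lam_tail.
(* The diagonal of the conjugated tensor product is the product of the one-letter measured laws. *)
- move=> y; rewrite tensWE tens_adj !tensM; apply: le_trans (sig_tail y).
  rewrite -(sum_enum_val (fun w => ~~ G (type_of y) w)).
  rewrite le_eqVlt; apply/orP; left; apply/eqP; apply: eq_bigr => a _.
  rewrite tensE (eq_bigr (fun k =>
    ((measured (W (y k)) (rho (type_of y)) (ev a k))%:C)%C)); last first.
    by move=> k _; apply: measured_complexE.
  by rewrite -rmorph_prod.
move=> y; rewrite (sum_enum_val (J y) (fun w => lam y w ^+ 2)).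
have -> : #|[pred a | G (type_of y) (ev a)]| = #|G (type_of y)|.
  rewrite -[LHS]sum1_card -[RHS]sum1_card.
  exact: (sum_enum_val (G (type_of y)) (fun=> 1%N)).
apply: le_trans (ler_pM _ _ (card_G y) (sum_lam_sqr y)) _ => //.
  by apply: sumr_ge0 => w _; apply: sqr_ge0.
(* The exponents of rank and purity add up to [n * (mutinf + 2 * dl)] at the type of [y], itself a
   distribution bounded by [Ir]. *)
rewrite -powR2D powR2_le.
have := Ir _ (type_distr_distr y); rewrite (mutinfE W_density (type_distr_distr y)).
rewrite -/(in_ent _) -/(rho _) -/(out_ent _) => /(ler_wpM2l (ler0n R n)).
rewrite /wid; lra.
Qed.

End TypeClasses.

(** * The asymptotic rate *)

(** The choice of [b] gives [(n+1) b <= 1 + x <= expR x], where [expR x] to the power [k+1] is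
    [2^(n a)]. One power beyond [k] leaves the factor [1/(n+1)]. *)
Lemma poly_mul_powR2N_le (R : realType) (k : nat) (a : R) : 0 < a ->
  exists c : R, forall n : nat,
    n.+1%:R ^+ k * 2 `^ (- (n%:R * a)) <= c * n.+1%:R^-1.
Proof.
move=> a0; pose b := Num.min 1 (a * ln 2 / k.+1%:R).
have k0 : 0 < k.+1%:R :> R by rewrite ltr0n.
have b0 : 0 < b.
  by rewrite lt_min ltr01 divr_gt0 // mulr_gt0 // ln2_gt0.
exists (b ^- k.+1) => n.
have n0 : 0 < n.+1%:R :> R by rewrite ltr0n.
pose x : R := n%:R * (a * ln 2 / k.+1%:R).
have h : n.+1%:R * b <= expR x.
  apply: le_trans (expR_ge1Dx _).
  rewrite -natr1 mulrDl mul1r addrC lerD //; first by rewrite ge_min lexx.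
  by rewrite /x ler_wpM2l // ge_min lexx orbT.
have E : 2 `^ (- (n%:R * a)) = (expR x ^+ k.+1)^-1.
  rewrite powRN /powR pnatr_eq0 /= -expRM_natl; congr (expR _)^-1.
  by rewrite /x; field; rewrite gt_eqF.
have : (n.+1%:R * b) ^+ k.+1 <= expR x ^+ k.+1.
  by rewrite ler_pXn2r ?nnegrE ?expR_ge0 // mulr_ge0 // ltW.
rewrite E -lef_pV2 ?posrE ?exprn_gt0 ?expR_gt0 ?mulr_gt0 // => h2.
apply: le_trans (ler_wpM2l _ h2) _; first by rewrite exprn_ge0.
have u0 : n.+1%:R ^+ k != 0 :> R by rewrite expf_neq0 // gt_eqF.
have v0 : b ^+ k.+1 != 0 by rewrite expf_neq0 // gt_eqF.
rewrite exprMn (exprS n.+1%:R); move: u0 v0.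
move: (_ ^+ k) (b ^+ k.+1) => u v u0 v0.
by rewrite le_eqVlt; apply/orP; left; apply/eqP; field; rewrite u0 v0 gt_eqF.
Qed.

Lemma floor_half_le (R : realType) (z : R) : 1 <= z ->
  exists2 M : nat, Num.floor z = M%:Z & (0 < M)%N /\ z <= 2 * M%:R.
Proof.
move=> z1; have f1 : 1 <= Num.floor z by rewrite real_floor_ge_int ?num_real.
exists `|Num.floor z|%N; first by rewrite gez0_abs // (le_trans _ f1).
have fE : `|Num.floor z|%N%:R = (Num.floor z)%:~R :> R.
  by rewrite natr_absz ger0_norm // (le_trans _ f1).
split; first by rewrite absz_gt0 gt_eqF // (lt_le_trans _ f1).
have := real_floorD1_gt (num_real z); rewrite fE intrD.
have : (1 : R) <= (Num.floor z)%:~R by rewrite (ler_int R 1).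
lra.
Qed.

Section Rate.
Variables (R : realType) (X : finType) (d : nat) (W : X -> 'M[R[i]]_d).
Hypothesis W_density : forall x, density (W x).
Local Open Scope classical_set_scope.

(** A letter supplies a distribution on words, so the supremum is not taken over the empty set,
    where it would be minus infinity. *)
Lemma eps_ge0 (n : nat) (M : int) : (0 < #|X|)%N -> (0 <= eps W n M)%E.
Proof.
move=> /card_gt0P[x0 _].
pose p : {ffun {ffun 'I_n -> X} -> R} := [ffun y => (y == [ffun=> x0])%:R].
have pd : is_distr p.
  split=> [y|]; first by rewrite ffunE.
  rewrite (bigD1 [ffun=> x0]) //= ffunE eqxx big1 ?addr0 // => y /negPf yx.
  by rewrite ffunE yx.
apply: le_trans (ereal_sup_ubound _); last by exists p.
apply: le_ereal_inf_tmp => _ [q _ <-].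
by rewrite lee_fin mulr_ge0 ?invr_ge0 // trnorm_ge0.
Qed.

Lemma eps_le (n : nat) (M : nat) (r dl : R) :
  (forall p : {ffun X -> R}, is_distr p -> mutinf W p <= r) ->
  (0 < n)%N -> (0 < M)%N -> 0 < dl ->
  (eps W n M%:Z <= (Num.sqrt (tail_bound d n dl) + tail_bound d n dl
    + n.+1%:R ^+ #|X| * Num.sqrt (2 `^ (n%:R * (r + 2 * dl)) / M%:R))%:E)%E.
Proof.
move=> Ir n0 M0 dl0; apply: ge_ereal_sup => _ [p pd <-].
have [q [qd qM qle]] := tensor_covering W_density n0 dl0 Ir pd M0.
apply: le_trans (ereal_inf_lbound _) _; first by exists q.
have cardT : #|{ffun X -> 'I_n.+1}|%:R = n.+1%:R ^+ #|X| :> R.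
  by rewrite card_ffun card_ord natrX.
rewrite lee_fin; move: qle; rewrite cardT.
set A := trnorm _; set s := Num.sqrt (tail_bound _ _ _); set e := tail_bound _ _ _.
set B := _ * Num.sqrt _ => qle.
have B0 : 0 <= B by rewrite mulr_ge0 ?sqrtr_ge0 ?exprn_ge0.
lra.
Qed.

Lemma eps_cvg0 (r g : R) : (0 < #|X|)%N -> 0 < r -> 0 < g ->
  (forall p : {ffun X -> R}, is_distr p -> mutinf W p <= r) ->
  eps W n (Num.floor (2 `^ (n%:R * (r + g)))) @[n --> \oo] --> 0%E.
Proof.
move=> X0 r0 g0 Ir.
have [c2 c2P] := @poly_mul_powR2N_le R #|X| (g / 4) (divr_gt0 g0 (ltr0Sn _ 3)).
(* The gap between [r + g] and [r + 2 * dl] is then [2 * dl]; after the square root a decay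
   [2^(-n dl)] remains to beat the number of types. *)
pose dl := g / 4; have dl0 : 0 < dl by rewrite divr_gt0.
(* The factor 2 pays for [1/n <= 2/(n+1)], since [harmonic n] is [1/(n+1)]. *)
pose c1 : R := 2 * (d%:R * (4 / ln 2 ^+ 2) / dl ^+ 2).
pose beta (h : R) : R := Num.sqrt (c1 * h) + c1 * h + Num.sqrt 2 * c2 * h.
have beta0 : beta 0 = 0 by rewrite /beta !mulr0 sqrtr0 !addr0.
have beta_cont : {for 0, continuous beta}.
  apply: continuousD; last by apply: continuousM => //; apply: cst_continuous.
  apply: continuousD; last by apply: continuousM => //; apply: cst_continuous.
  apply: (@continuous_comp _ _ _ ( *%R c1) (@Num.sqrt R)).
    by apply: continuousM => //; apply: cst_continuous.
  exact: sqrt_continuous.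
have beta_cvg : beta (harmonic n) @[n --> \oo] --> (0 : R).
  by rewrite -[X in _ --> X]beta0; apply: continuous_cvg => //; apply: cvg_harmonic.
have beta_cvgE : (beta (harmonic n))%:E @[n --> \oo] --> 0%E.
  by apply: cvg_EFin; [near=> n | exact: beta_cvg].
apply: (@squeeze_cvge _ _ _ _ (fun=> 0%E) _ (fun n => (beta (harmonic n))%:E));
  [|exact: cvg_cst|exact: beta_cvgE].
near=> n; rewrite eps_ge0 //=.
have n0 : (0 < n)%N by near: n; exists 1%N.
have n0R : 0 < n%:R :> R by rewrite ltr0n.
set z := 2 `^ _.
have z1 : 1 <= z by rewrite -(powRr0 2) powR2_le mulr_ge0 // addr_ge0 ?ltW.
have [M -> [M0 zM]] := floor_half_le z1.
apply: le_trans (eps_le Ir n0 M0 dl0) _; rewrite lee_fin /beta.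
have c10 : 0 <= d%:R * (4 / ln 2 ^+ 2) / dl ^+ 2 :> R.
  by rewrite !(mulr_ge0, invr_ge0, exprn_ge0) // ltW // ln2_gt0.
have tle : tail_bound d n dl <= c1 * harmonic n.
  set D := (X in 0 <= X) in c10.
  have -> : tail_bound d n dl = D * n%:R^-1.
    rewrite /tail_bound /D; field.
    by rewrite !gt_eqF ?ln2_gt0.
  have -> : c1 * harmonic n = D * (2 / n.+1%:R) by rewrite /c1 /D /=; ring.
  rewrite ler_wpM2l // ler_pdivlMr ?ltr0n // ler_pdivrMl // -natr1.
  have : 1 <= n%:R :> R by rewrite ler1n.
  lra.
have M0R : 0 < M%:R :> R by rewrite ltr0n.
apply: lerD.
  by apply: lerD => //; rewrite ler_wsqrtr.
(* Rounding down to [M] costs the factor 2, by [z <= 2 * M]. *)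
have Kle : 2 `^ (n%:R * (r + 2 * dl)) / M%:R <= 2 * (2 `^ (- (n%:R * dl))) ^+ 2.
  rewrite ler_pdivrMr // expr2.
  have -> : n%:R * (r + 2 * dl) = - (n%:R * dl) - n%:R * dl + n%:R * (r + g).
    by rewrite /dl; field.
  rewrite 2!powR2D -/z; set P := 2 `^ (- (n%:R * dl)).
  have -> : 2 * (P * P) * M%:R = P * P * (2 * M%:R) by ring.
  by rewrite ler_wpM2l ?mulr_ge0 ?powR_ge0.
apply: (@le_trans _ _ (n.+1%:R ^+ #|X| * (Num.sqrt 2 * 2 `^ (- (n%:R * dl))))).
  rewrite ler_wpM2l ?exprn_ge0 // (le_trans (ler_wsqrtr Kle)) //.
  by rewrite sqrtrM // sqrtr_sqr ger0_norm ?powR_ge0.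
by rewrite mulrCA -mulrA ler_wpM2l ?sqrtr_ge0 //.
Unshelve. all: by end_near.
Qed.

End Rate.

Theorem theorem3 (R : realType) (X : finType) (d : nat)
  (W : X -> 'M[R[i]]_d) :
  (0 < #|X|)%N ->
  (forall x : X, density (W x)) ->
  (rateW W <= capacity W)%E.
Proof.
move=> X0 W_density.
have cap_ub p : is_distr p -> ((mutinf W p)%:E <= capacity W)%E.
  by move=> pd; apply: ereal_sup_ubound; exists p.
have cap0 : (0 <= capacity W)%E.
  have /card_gt0P[x _] := X0.
  by have [p /cap_ub + p0] := exists_mutinf0 W x; rewrite p0.
(* Working strictly above the capacity ensures [0 < r], as [rateW] demands; the capacity itself may
   be 0. *)
have rate_le r : (capacity W < r%:E)%E -> (rateW W <= r%:E)%E.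
  move=> cr; apply: ereal_inf_lbound; exists r => //=.
  have r0 : 0 < r by rewrite -lte_fin (le_lt_trans cap0).
  split=> // g g0.
  have Ir p : is_distr p -> mutinf W p <= r.
    by move=> pd; rewrite -lee_fin (le_trans (cap_ub _ pd)) // ltW.
  by have [-> _] := cvg_limn_einf_sup (eps_cvg0 W_density X0 r0 g0 Ir).
(* The strict inequality is removed by letting [r] decrease to a finite capacity; an infinite one is
   trivial, and minus infinity is excluded by [cap0]. *)
apply/lee_addgt0Pr => e e0; move: cap0 rate_le.
case: (capacity W) => [c|_ _|//]; last by rewrite leey.
by move=> _ h; apply: h; rewrite lte_fin ltrDl.
Qed.
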